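(* Let $\Lambda\subset\Gamma$ be Fitting orders over a Fitting domain $\mathfrak{o}$ in an algebra $A$, and let $M$ be a finitely generated $\Lambda$-module. Then $$\mathrm{Fit}^{\max}_{\Lambda}(M)\cdot\mathcal{U}(\Gamma)\subset\mathrm{Fit}^{\max}_{\Gamma}(\Gamma\otimes_{\Lambda}M).$$
   Context: Modules are left modules; $\zeta(\cdot)$ denotes the centre of a ring. A Fitting domain is an integrally closed complete commutative noetherian local domain $\mathfrak{o}$; let $F$ be its field of quotients. A Fitting order over $\mathfrak{o}$ is an $\mathfrak{o}$-order in a (finite dimensional) separable $F$-algebra $A$. The reduced norm $\mathrm{nr}: M_{b\times b}(A)\to\zeta(A)$ is defined componentwise on the simple components of $A$. For a Fitting order $\Lambda$ put $\mathcal{U}(\Lambda) := \langle \mathrm{nr}(H) \mid H \in \mathrm{GL}_b(\Lambda), b\in\mathbb{N}\rangle_{\zeta(\Lambda)} \subset \zeta(A)$, the $\zeta(\Lambda)$-span. For a finite presentation $\Lambda^a \xrightarrow{h} \Lambda^b \twoheadrightarrow M$, identify $h$ with a matrix in $M_{a\times b}(\Lambda)$ (acting by right multiplication on row vectors), let $S_b(h)$ be the set of its $b\times b$ submatrices when $a\ge b$, and put $\mathrm{Fit}_\Lambda(h) := \langle \mathrm{nr}(H) \mid H\in S_b(h)\rangle_{\mathcal{U}(\Lambda)}$ if $a\ge b$ and $\mathrm{Fit}_\Lambda(h) := 0$ if $a<b$. Then $\mathrm{Fit}^{\max}_\Lambda(M)$ is the unique maximal element with respect to inclusion (which exists) among all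 $\mathrm{Fit}_\Lambda(h)$, $h$ running through the finite presentations of $M$; likewise for $\Gamma$. *)

(* Defs.v *)
From HB Require Import structures.
From mathcomp Require Import all_boot all_order all_algebra all_field.
From mathcomp Require Import classical_sets.

Set Implicit Arguments.
Unset Strict Implicit.
Unset Printing Implicit Defensive.

Import GRing.Theory.
Local Open Scope ring_scope.
Local Open Scope classical_set_scope.

Section Spans.
Variable R : nzRingType.

(* The C-span of S when C is a ring, and the product C.S when C is an ideal or
   submodule. *)
Definition lspan (C S : set R) : set R :=
  [set x | exists (k : nat) (c s : 'I_k -> R),
     [/\ forall i, C (c i), forall i, S (s i) & x = \sum_i c i * s i]].

Definition centre (S : set R) : set R :=
  [set x | S x /\ forall y, S y -> x * y = y * x].

End Spans.

Section FittingDomain.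
Variable o : idomainType.

Definition is_ideal (I : set o) : Prop :=
  [/\ I 0, forall x y, I x -> I y -> I (x + y) & forall r x, I x -> I (r * x)].

Definition noetherian : Prop :=
  forall I : set o, is_ideal I -> exists s : seq o, I = lspan setT [set` s].

Definition maximal_ideal (m : set o) : Prop :=
  [/\ is_ideal m, ~ m 1 &
      forall J, is_ideal J -> m `<=` J -> J = m \/ J = setT].

Fixpoint ideal_pow (m : set o) (k : nat) : set o :=
  if k is k'.+1 then lspan m (ideal_pow m k') else setT.

Definition adic_cauchy (m : set o) (u : nat -> o) : Prop :=
  forall k, exists N : nat, forall i j : nat,
    (N <= i)%N -> (N <= j)%N -> ideal_pow m k (u i - u j).

Definition adic_limit (m : set o) (u : nat -> o) (l : o) : Prop :=
  forall k, exists N : nat, forall i : nat,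
    (N <= i)%N -> ideal_pow m k (u i - l).

Definition adic_complete (m : set o) : Prop :=
  (forall x, (forall k, ideal_pow m k x) -> x = 0) /\
  (forall u, adic_cauchy m u -> exists l, adic_limit m u l).

Definition integrally_closed : Prop :=
  forall x : {fraction o},
    integralOver (@tofrac o) x -> exists y : o, x = tofrac y.

Definition fitting_domain : Prop :=
  [/\ noetherian, integrally_closed &
      exists m : set o,
        [/\ maximal_ideal m, forall m', maximal_ideal m' -> m' = m &
            adic_complete m]].

End FittingDomain.

Section Separable.
Variables (F : fieldType) (A : falgType F).

Definition semisimple : Prop :=
  forall U : {vspace A}, (fullv * U <= U)%VS ->
    exists V : {vspace A},
      [/\ (fullv * V <= V)%VS, (U + V)%VS = fullv & (U :&: V)%VS = 0%VS].

Definition two_sided (B : {vspace A}) : Prop :=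
  (fullv * B <= B)%VS /\ (B * fullv <= B)%VS.

(* For semisimple A, the simple components are the minimal nonzero two-sided
   ideals. *)
Definition simple_component (B : {vspace A}) : Prop :=
  [/\ two_sided B, B <> 0%VS &
      forall C, two_sided C -> (C <= B)%VS -> C = 0%VS \/ C = B].

(* Semisimple, and the centre of every simple component is a separable field
   extension of F.  The identity of a component B is not 1, so its centre is
   presented as the image of a field extension L by a (non-unital) embedding. *)
Definition separable_algebra : Prop :=
  semisimple /\
  forall B, simple_component B ->
    exists (L : fieldExtType F) (f : 'Hom(L, A)),
      [/\ injective f, {morph f : x y / x * y}, limg f = 'Z(B)%VS &
          separable 1%AS {:L}%AS].

(* phi maps Z(B) to scalars, which makes E an extension of the field Z(B), and
   the induced map from the tensor product of E and B over Z(B) to M_n(E) is an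
   isomorphism: it is onto, and B has dimension n^2 over Z(B).  In particular
   phi maps the identity of B to 1, hence it kills the other components. *)
Definition splits (B : {vspace A}) (E : fieldType) (n : nat)
    (phi : {rmorphism A -> 'M[E]_n}) : Prop :=
  [/\ forall z, z \in 'Z(B)%VS -> is_scalar_mx (phi z),
      <<[seq phi x | x <- vbasis B]>>%VS = fullv &
      \dim B = (n ^ 2 * \dim 'Z(B))%N].

(* z is the reduced norm of H: z is central and, on each simple component B, it
   is the determinant of the image of H in M_b(M_n(E)) = M_(bn)(E) for any
   splitting of B over an extension E of Z(B).  Such a z exists, does not
   depend on the splittings, and is unique, as each component has a splitting
   field and phi is injective on B. *)
Definition is_nr (b : nat) (H : 'M[A]_b) (z : A) : Prop :=
  centre setT z /\
  forall B, simple_component B ->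
  forall (E : fieldType) (n : nat) (phi : {rmorphism A -> 'M[E]_n}),
    splits B phi ->
    phi z = (\det (\mxblock_(i < b, j < b) phi (H i j)))%:M.

End Separable.

Section Subring.
Variables (R : nzRingType) (S : subringClosed R).

Record subring := Subring {subring_val :> R; subring_valP : subring_val \in S}.

HB.instance Definition _ := [isSub for subring_val].
HB.instance Definition _ := [Choice of subring by <:].
HB.instance Definition _ := [SubChoice_isSubNzRing of subring by <:].

End Subring.

Definition subring_incl (R : nzRingType) (S S' : subringClosed R)
    (sub : {subset S <= S'}) (x : subring S) : subring S' :=
  Subring (sub _ (subring_valP x)).

Section Order.
Variables (o : idomainType) (A : falgType {fraction o}).

(* L is a subring of A (with the same 1) which is a finitely generated
   o-submodule containing an F-basis of A. *)
Definition is_order (L : subringClosed A) : Prop :=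
  exists s : seq A,
    (forall x, x \in L <->
       exists c : 'I_(size s) -> o, x = \sum_i tofrac (c i) *: s`_i) /\
    <<s>>%VS = fullv.

Definition fitting_order (L : subringClosed A) : Prop :=
  [/\ fitting_domain o, separable_algebra A & is_order L].

End Order.

Section TensorProduct.
Variables (R S : nzRingType) (f : R -> S) (M : lmodType R).

Definition balanced (N : zmodType) (beta : S -> M -> N) : Prop :=
  [/\ forall s s' m, beta (s + s') m = beta s m + beta s' m,
      forall s m m', beta s (m + m') = beta s m + beta s m' &
      forall s r m, beta (s * f r) m = beta s (r *: m)].

(* (T, tau) is the tensor product of S and M over R, where S is a right
   R-module via f, with its left S-module structure. *)
Definition is_tensor (T : lmodType S) (tau : S -> M -> T) : Prop :=
  [/\ balanced tau,
      forall s s' m, s *: tau s' m = tau (s * s') m &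
      forall (N : zmodType) (beta : S -> M -> N), balanced beta ->
        exists psi : {additive T -> N},
          (forall s m, psi (tau s m) = beta s m) /\
          forall psi' : {additive T -> N},
            (forall s m, psi' (tau s m) = beta s m) -> psi' =1 psi].

End TensorProduct.

Definition finitely_generated (R : nzRingType) (M : lmodType R) : Prop :=
  exists s : seq M, forall m : M,
    exists c : 'I_(size s) -> R, m = \sum_i c i *: s`_i.

Definition presents (R : nzRingType) (M : lmodType R) (a b : nat)
    (h : 'M[R]_(a, b)) : Prop :=
  exists p : {linear 'rV[R]_b -> M},
    (forall m, exists v, p v = m) /\
    (forall v, p v = 0 <-> exists u : 'rV[R]_a, v = u *m h).

Section Fitting.
Variables (F : fieldType) (A : falgType F) (L : subringClosed A).

Definition to_mx (a b : nat) (h : 'M[subring L]_(a, b)) : 'M[A]_(a, b) :=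
  map_mx (@subring_val A L) h.

Definition is_GL (b : nat) (H : 'M[subring L]_b) : Prop :=
  exists H' : 'M[subring L]_b, H *m H' = 1%:M /\ H' *m H = 1%:M.

Definition U_ : set A :=
  lspan (centre [set x | x \in L])
    [set z | exists (b : nat) (H : 'M[subring L]_b),
       is_GL H /\ is_nr (to_mx H) z].

(* An increasing choice of b rows; all b columns are kept. *)
Definition submatrices (a b : nat) (h : 'M[subring L]_(a, b)) :
    set 'M[subring L]_b :=
  [set H | exists f : 'I_b -> 'I_a,
     {homo f : i j / (i < j)%N} /\ H = rowsub f h].

Definition Fit (a b : nat) (h : 'M[subring L]_(a, b)) : set A :=
  if (b <= a)%N then
    lspan U_ [set z | exists H, submatrices h H /\ is_nr (to_mx H) z]
  else [set 0].

Definition Fit_family (M : lmodType (subring L)) : set (set A) :=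
  [set X | exists (a b : nat) (h : 'M[subring L]_(a, b)),
     presents M h /\ X = Fit h].

Definition maximal_in (T : Type) (P : set (set T)) (X : set T) : Prop :=
  P X /\ forall Y, P Y -> X `<=` Y -> Y = X.

(* X is the unique maximal element of Fit_family M. *)
Definition is_Fitmax (M : lmodType (subring L)) (X : set A) : Prop :=
  maximal_in (Fit_family M) X /\
  forall Y, maximal_in (Fit_family M) Y -> Y = X.

End Fitting.

(* Main.v *)
(* Reduced norms are multiplicative on block triangular matrices.  Hence U(Gam)
   is closed under products, and, given presentations h1 and h2 of the same
   module, all their relations together with those expressing each family of
   generators in terms of the other give a presentation whose Fitting invariant
   contains both Fit(h1) and Fit(h2).  So a maximal Fitting invariant is the
   greatest one, without any chain condition.  Since tensoring is right exact, a
   presentation h of M also presents Gam (x) M over Gam, and every generator of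
   Fit_Lam(h) is a generator of Fit_Gam(h); finally U(Lam) is contained in U(Gam)
   because Lam spans A, so that the centre of Lam is central in A. *)
Require Import Defs.
From HB Require Import structures.
From mathcomp Require Import all_boot all_order perm all_algebra all_field.
From mathcomp Require Import boolp classical_sets.

Set Implicit Arguments.
Unset Strict Implicit.
Unset Printing Implicit Defensive.

Import GRing.Theory.
Local Open Scope ring_scope.
Local Open Scope classical_set_scope.

(** * Determinants of matrices of blocks *)

Lemma det_reindex (R : comNzRingType) (I : finType) (m1 m2 : nat)
    (f1 : 'I_m1 -> I) (f2 : 'I_m2 -> I) (G : I -> I -> R) :
  bijective f1 -> bijective f2 ->
  \det (\matrix_(i, j) G (f1 i) (f1 j)) = \det (\matrix_(i, j) G (f2 i) (f2 j)).
Proof.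
move=> f1bij f2bij.
have em : m1 = m2.
  by rewrite -[m1]card_ord (bij_eq_card f1bij) -(bij_eq_card f2bij) card_ord.
case: m2 / em f2 f2bij => f2 f2bij.
have [g gK Kg] := f2bij.
have sinj : injective (g \o f1).
  by apply: inj_comp; [exact: can_inj Kg | exact: bij_inj].
set M := \matrix_(i, j) G (f2 i) (f2 j).
(* The same permutation acts on rows and on columns, so its sign enters squared. *)
have -> : \matrix_(i, j) G (f1 i) (f1 j) =
    row_perm (perm sinj) (col_perm (perm sinj) M).
  by apply/matrixP => i j; rewrite !mxE !permE /= !Kg.
by rewrite row_permE col_permE !det_mulmx !det_perm odd_permV mulrCA -expr2 sqrr_sign mulr1.
Qed.

Section MxblockDet.
Variables (E : comNzRingType) (n b1 b2 : nat).

Let blk (a b : nat) (B : 'I_a -> 'I_b -> 'M[E]_n) :=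
  \mxblock_(i < a, j < b) B i j.

(** The matrices are indexed by ['I_(\sum_(i < b1 + b2) n)] and
    ['I_(\sum_(i < b1) n + \sum_(i < b2) n)]. Both types enumerate the pairs (block, position in the
    block), so [det_reindex] applies. *)
Lemma det_mxblock_block (B : 'I_(b1 + b2) -> 'I_(b1 + b2) -> 'M[E]_n) :
  \det (blk B) =
  \det (block_mx (blk (fun i j => B (lshift b2 i) (lshift b2 j)))
                 (blk (fun i j => B (lshift b2 i) (rshift b1 j)))
                 (blk (fun i j => B (rshift b1 i) (lshift b2 j)))
                 (blk (fun i j => B (rshift b1 i) (rshift b1 j)))).
Proof.
pose G (u v : 'I_(b1 + b2) * 'I_n) := B u.1 v.1 u.2 v.2.
pose ix (b : nat) (s : 'I_(\sum_(i < b) n)) : 'I_b * 'I_n :=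
  (tagnat.sig1 s, tagnat.sig2 s).
pose f2 (s : 'I_(\sum_(i < b1) n + \sum_(i < b2) n)) :=
  match split s with
  | inl s1 => (lshift b2 (ix b1 s1).1, (ix b1 s1).2)
  | inr s2 => (rshift b1 (ix b2 s2).1, (ix b2 s2).2)
  end.
have ixI b : injective (ix b).
  move=> s t [e1 e2]; rewrite -[s]tagnat.sig2K -[t]tagnat.sig2K.
  by move: (tagnat.sig2 s) (tagnat.sig2 t) e2; rewrite e1 => ? ? ->.
transitivity (\det (\matrix_(s, t) G (ix (b1 + b2)%N s) (ix (b1 + b2)%N t))).
  by congr (\det _); apply/matrixP => s t; rewrite !mxE.
rewrite (@det_reindex _ _ _ _ (ix (b1 + b2)%N) f2 G).
- congr (\det _); apply/matrixP => s t; rewrite !mxE /f2.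
  by case: (split s) => s'; rewrite !mxE; case: (split t) => t'; rewrite !mxE.
- by apply: inj_card_bij (ixI _) _; rewrite card_prod !card_ord sum_nat_const card_ord.
- apply: inj_card_bij; last first.
    by rewrite card_prod !card_ord !sum_nat_const !card_ord mulnDl.
  move=> s t; rewrite /f2.
  case: split_ordP => s' ->; case: split_ordP => t' -> [/= e1 e2].
  + by congr lshift; apply: ixI; congr (_, _) => //; apply/val_inj.
  (* In the mixed cases a block number below [b1] would equal one that is at least [b1]. *)
  + by have := ltn_ord (tagnat.sig1 s'); rewrite e1 ltnNge leq_addr.
  + by have := ltn_ord (tagnat.sig1 t'); rewrite -e1 ltnNge leq_addr.
  + congr rshift; apply: ixI; congr (_, _) => //; apply/val_inj.
    exact: (addnI e1).
Qed.

End MxblockDet.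

(** * Reduced norms of block triangular matrices *)

Section ReducedNorm.
Variables (F : fieldType) (A : falgType F).

Let blk_phi (E : fieldType) n (phi : A -> 'M[E]_n) (a b : nat) (H : 'M[A]_(a, b)) :=
  \mxblock_(i < a, j < b) phi (H i j).

Let det_blk (E : fieldType) n (phi : {rmorphism A -> 'M[E]_n}) (b1 b2 : nat)
    (H1 : 'M[A]_b1) (K : 'M[A]_(b1, b2)) (L : 'M[A]_(b2, b1)) (H2 : 'M[A]_b2) :
  \det (blk_phi phi (block_mx H1 K L H2)) =
  \det (block_mx (blk_phi phi H1) (blk_phi phi K)
                 (blk_phi phi L) (blk_phi phi H2)).
Proof.
rewrite /blk_phi det_mxblock_block; congr (\det (block_mx _ _ _ _)).
all: apply: eq_mxblock => i j.
all: by rewrite ?(block_mxEul, block_mxEur, block_mxEdl, block_mxEdr).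
Qed.

Let blk_phi0 (E : fieldType) n (phi : {rmorphism A -> 'M[E]_n}) (a b : nat) :
  blk_phi phi (0 : 'M[A]_(a, b)) = 0.
Proof. by apply/matrixP => s t; rewrite !mxE rmorph0 mxE. Qed.

Lemma centreM (R : nzRingType) (S : subringClosed R) (x y : R) :
  centre [set x | x \in S] x -> centre [set x | x \in S] y ->
  centre [set x | x \in S] (x * y).
Proof.
move=> [Sx cx] [Sy cy]; split; first exact: rpredM.
by move=> u Su; rewrite -mulrA cy // !mulrA cx.
Qed.

Let centreTM (x y : A) : centre setT x -> centre setT y -> centre setT (x * y).
Proof.
by move=> [_ cx] [_ cy]; split=> // u _; rewrite -mulrA cy // !mulrA cx.
Qed.

(** Every splitting sends the zero block to zero, so the matrix over [E] is again block triangular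
    and its determinant is the product of those of the diagonal blocks. *)
Lemma is_nr_ublock (b1 b2 : nat) (H1 : 'M[A]_b1) (K : 'M[A]_(b1, b2))
    (H2 : 'M[A]_b2) (z1 z2 : A) :
  is_nr H1 z1 -> is_nr H2 z2 -> is_nr (block_mx H1 K 0 H2) (z1 * z2).
Proof.
move=> [c1 nr1] [c2 nr2]; split; first exact: centreTM.
move=> B Bsimple E n phi phiB.
rewrite -/(blk_phi phi _) det_blk blk_phi0 det_ublock rmorphM /=.
by rewrite (nr1 B Bsimple E n phi phiB) (nr2 B Bsimple E n phi phiB) scalar_mxM.
Qed.

Lemma is_nr_lblock (b1 b2 : nat) (H1 : 'M[A]_b1) (L : 'M[A]_(b2, b1))
    (H2 : 'M[A]_b2) (z1 z2 : A) :
  is_nr H1 z1 -> is_nr H2 z2 -> is_nr (block_mx H1 0 L H2) (z1 * z2).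
Proof.
move=> [c1 nr1] [c2 nr2]; split; first exact: centreTM.
move=> B Bsimple E n phi phiB.
rewrite -/(blk_phi phi _) det_blk blk_phi0 det_lblock rmorphM /=.
by rewrite (nr1 B Bsimple E n phi phiB) (nr2 B Bsimple E n phi phiB) scalar_mxM.
Qed.

(** Provides the reduced norm of the identity block in the minors of a joined presentation. *)
Lemma is_nr1 (b : nat) : is_nr (1%:M : 'M[A]_b) 1.
Proof.
split; first by split=> // y _; rewrite mul1r mulr1.
move=> B Bsimple E n phi phiB.
suff -> : \mxblock_(i < b, j < b) phi ((1%:M : 'M[A]_b) i j) = 1%:M.
  by rewrite det1 rmorph1.
rewrite -mxdiagZ /mxdiag; apply: eq_mxblock => i j.
rewrite mxE; case: (i == j); last by rewrite rmorph0.
by rewrite rmorph1 conform_mx_id.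
Qed.

End ReducedNorm.

(** * Spans and induction on their generators *)

Section SpanTheory.
Variable R : nzRingType.
Implicit Types C S P : set R.

Lemma lspan_gen C S c s : C c -> S s -> lspan C S (c * s).
Proof.
by move=> Cc Ss; exists 1%N, (fun=> c), (fun=> s); split=> //; rewrite big_ord1.
Qed.

Lemma lspan0 C S : lspan C S 0.
Proof. by exists 0%N, (fun=> 0), (fun=> 0); split=> [[]|[]|] //; rewrite big_ord0. Qed.

Lemma lspanD C S x y : lspan C S x -> lspan C S y -> lspan C S (x + y).
Proof.
move=> [k [c [s [Cc Ss ->]]]] [k' [c' [s' [Cc' Ss' ->]]]].
pose glue (f : 'I_k -> R) (f' : 'I_k' -> R) (i : 'I_(k + k')) :=
  match split i with inl j => f j | inr j => f' j end.
exists (k + k')%N, (glue c c'), (glue s s').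
split; try by move=> i; rewrite /glue; case: split.
rewrite big_split_ord /glue /=; congr (_ + _); apply: eq_bigr => i _.
  by rewrite (unsplitK (inl i)).
by rewrite (unsplitK (inr i)).
Qed.

Lemma lspan_sub C S P : P 0 -> (forall x y, P x -> P y -> P (x + y)) ->
  (forall c s, C c -> S s -> P (c * s)) -> lspan C S `<=` P.
Proof.
move=> P0 PD Pgen x [k [c [s [Cc Ss ->]]]].
by elim/big_ind: _ => // i _; apply: Pgen.
Qed.

Lemma lspan_mulr C S y :
  (forall s, S s -> forall c, C c -> lspan C S (c * s * y)) ->
  forall x, lspan C S x -> lspan C S (x * y).
Proof.
move=> Sy x; apply: (lspan_sub (P := [set x | lspan C S (x * y)])) => /=.
- by rewrite mul0r; exact: lspan0.
- by move=> u v Su Sv; rewrite mulrDl; exact: lspanD.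
- by move=> c s Cc Ss; exact: Sy.
Qed.

End SpanTheory.

(** * Inclusions of subrings as ring morphisms *)

Section SubringTheory.
Variables (R : nzRingType) (S S' : subringClosed R) (sub : {subset S <= S'}).

Lemma subring_incl_is_zmod_morphism : zmod_morphism (subring_incl sub).
Proof. by move=> x y; apply: val_inj; exact: (raddfB (val : subring S -> R)). Qed.

HB.instance Definition _ := GRing.isZmodMorphism.Build (subring S) (subring S')
  (subring_incl sub) subring_incl_is_zmod_morphism.

Lemma subring_incl_is_monoid_morphism : monoid_morphism (subring_incl sub).
Proof.
by split=> [|x y]; apply: val_inj; [exact: (rmorph1 (val : subring S -> R)) |
  exact: (rmorphM (val : subring S -> R))].
Qed.

HB.instance Definition _ := GRing.isMonoidMorphism.Build (subring S) (subring S')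
  (subring_incl sub) subring_incl_is_monoid_morphism.

End SubringTheory.

(** * Closure of [U_] under products *)

Section UnitSpan.
Variables (F : fieldType) (A : falgType F) (L : subringClosed A).

Lemma to_mx_block (a1 a2 b1 b2 : nat) (H1 : 'M[subring L]_(a1, b1)) H2 H3
    (H4 : 'M[subring L]_(a2, b2)) :
  to_mx (block_mx H1 H2 H3 H4) = block_mx (to_mx H1) (to_mx H2) (to_mx H3) (to_mx H4).
Proof. exact: map_block_mx. Qed.

Lemma to_mx0 (a b : nat) : to_mx (0 : 'M[subring L]_(a, b)) = 0.
Proof. exact: (map_mx0 (val : {additive subring L -> A})). Qed.

Lemma to_mx1 (b : nat) : to_mx (1%:M : 'M[subring L]_b) = 1%:M.
Proof. exact: (map_mx1 (val : {rmorphism subring L -> A})). Qed.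

Lemma is_GL_block (b1 b2 : nat) (H1 : 'M[subring L]_b1) (H2 : 'M[subring L]_b2) :
  is_GL H1 -> is_GL H2 -> is_GL (block_mx H1 0 0 H2).
Proof.
move=> [K1 [HK1 KH1]] [K2 [HK2 KH2]]; exists (block_mx K1 0 0 K2).
by rewrite !mulmx_block !mulmx0 !mul0mx !addr0 !add0r HK1 KH1 HK2 KH2 -scalar_mx_block.
Qed.

(** Reduced norms are central in [A], so a product of two generators regroups as
    [c * c' * (z * z')], where [z * z'] is the reduced norm of the block diagonal matrix of [H] and
    [H']. *)
Lemma U_M x y : U_ L x -> U_ L y -> U_ L (x * y).
Proof.
move=> Ux Uy; move: x Ux; apply: lspan_mulr => z [b [H [HGL [cz nrz]]]] c Lc.
move: y Uy; apply: (lspan_sub (P := [set y | U_ L (c * z * y)])) => /=.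
- by rewrite mulr0; exact: lspan0.
- by move=> u v Pu Pv; rewrite mulrDr; exact: lspanD.
move=> c' z' Lc' [b' [H' [HGL' nrz']]].
have -> : c * z * (c' * z') = c * c' * (z * z').
  by rewrite -!mulrA; congr (_ * _); rewrite !mulrA; case: cz => _ ->.
apply: lspan_gen; first exact: centreM.
exists (b + b')%N, (block_mx H 0 0 H'); split; first exact: is_GL_block.
by rewrite to_mx_block !to_mx0; exact: is_nr_ublock.
Qed.

Lemma Fit0 (a b : nat) (h : 'M[subring L]_(a, b)) : Fit h 0.
Proof. by rewrite /Fit; case: ifP => // _; exact: lspan0. Qed.

Lemma FitD (a b : nat) (h : 'M[subring L]_(a, b)) x y :
  Fit h x -> Fit h y -> Fit h (x + y).
Proof.
rewrite /Fit; case: ifP => [_|_ -> ->]; first exact: lspanD.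
by rewrite addr0.
Qed.

End UnitSpan.

(** * Joining two presentations of one module *)

Section Presentations.
Variable R : nzRingType.

Lemma row_linear (M : lmodType R) (b : nat) (t : 'I_b -> M) :
  exists p : {linear 'rV[R]_b -> M}, forall v, p v = \sum_i v 0 i *: t i.
Proof.
pose p (v : 'rV[R]_b) := \sum_i v 0 i *: t i.
have p_lin : linear p.
  move=> a u v; rewrite /p scaler_sumr -big_split; apply: eq_bigr => i _ /=.
  by rewrite !mxE scalerDl scalerA.
pose q : {linear 'rV[R]_b -> M} :=
  HB.pack p (GRing.isLinear.Build R 'rV[R]_b M *:%R p p_lin).
by exists q.
Qed.

Lemma linear_rowE (M : lmodType R) (b : nat) (p : {linear 'rV[R]_b -> M}) v :
  p v = \sum_i v 0 i *: p (delta_mx 0 i).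
Proof.
by rewrite {1}[v]row_sum_delta linear_sum; apply: eq_bigr => i _; rewrite linearZ.
Qed.

Lemma linear_mulmxE (M : lmodType R) (a b : nat) (p : {linear 'rV[R]_b -> M})
    (u : 'rV[R]_a) (h : 'M[R]_(a, b)) :
  p (u *m h) = \sum_i u 0 i *: p (row i h).
Proof.
by rewrite mulmx_sum_row linear_sum; apply: eq_bigr => i _; rewrite linearZ.
Qed.

(** Free modules are projective: the rows of [al] are preimages under [p] of the images of the basis
    vectors under [p']. *)
Lemma lift_linear (M : lmodType R) (b b' : nat) (p : {linear 'rV[R]_b -> M})
    (p' : {linear 'rV[R]_b' -> M}) :
  (forall m, exists v, p v = m) ->
  exists al : 'M[R]_(b', b), forall v, p (v *m al) = p' v.
Proof.
move=> psurj.
have /fin_all_exists[w pw] (i : 'I_b') : exists w, p w = p' (delta_mx 0 i).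
  exact: psurj.
exists (\matrix_i w i) => v; rewrite linear_mulmxE [RHS]linear_rowE.
by apply: eq_bigr => i _; rewrite rowK pw.
Qed.

(** The rows of [al] express the second generators in the first ones, those of [be] the first in the
    second. The order of the blocks makes the upper half block lower triangular and the lower half
    block upper triangular. *)
Definition join_relations (a1 a2 b1 b2 : nat) (h1 : 'M[R]_(a1, b1))
    (h2 : 'M[R]_(a2, b2)) (al : 'M[R]_(b2, b1)) (be : 'M[R]_(b1, b2)) :
    'M[R]_((a1 + b2) + (b1 + a2), b1 + b2) :=
  col_mx (block_mx h1 0 (- al) 1%:M) (block_mx 1%:M (- be) 0 h2).

Lemma presents_join (M : lmodType R) (a1 a2 b1 b2 : nat) (h1 : 'M[R]_(a1, b1))
    (h2 : 'M[R]_(a2, b2)) :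
  presents M h1 -> presents M h2 ->
  exists al be, presents M (join_relations h1 h2 al be).
Proof.
move=> [p1 [p1surj p1ker]] [p2 [p2surj p2ker]].
have [al alE] := lift_linear p2 p1surj.
have [be beE] := lift_linear p1 p2surj.
exists al, be.
pose p : {linear 'rV[R]_(b1 + b2) -> M} := ((p1 \o lsubmx) \+ (p2 \o rsubmx)).
have pE x y : p (row_mx x y) = p1 x + p2 y by rewrite /p /= row_mxKl row_mxKr.
exists p; split.
  by move=> m; have [v <-] := p1surj m; exists (row_mx v 0); rewrite pE linear0 addr0.
move=> v; rewrite -[v]hsubmxK; move: (lsubmx v) (rsubmx v) => x y; rewrite pE; split.
  move=> pxy.
  have /p1ker[u xE] : p1 (x + y *m al) = 0 by rewrite linearD /= alE.
  (* The upper half already generates all relations: the rows [(-al, 1)] reduce [(x, y)] to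
     [(x + y *m al, 0)], and then [h1] takes over. *)
  exists (row_mx (row_mx u y) 0).
  rewrite /join_relations mul_row_col mul0mx addr0 mul_row_block mulmx0 add0r mulmx1.
  by rewrite mulmxN -xE addrK.
move=> [u]; rewrite -[u]hsubmxK; move: (lsubmx u) (rsubmx u) => u12 u34.
rewrite -[u12]hsubmxK -[u34]hsubmxK.
move: (lsubmx u12) (rsubmx u12) (lsubmx u34) (rsubmx u34) => u1 u2 u3 u4.
rewrite /join_relations mul_row_col !mul_row_block !mulmx0 !mulmx1 add0r addr0.
rewrite add_row_mx !mulmxN => /eq_row_mx[-> ->].
have p1h : p1 (u1 *m h1) = 0 by apply/p1ker; exists u1.
have p2h : p2 (u4 *m h2) = 0 by apply/p2ker; exists u4.
rewrite !linearD !linearN /= alE beE p1h p2h !add0r addr0.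
by rewrite addrACA addNr addrN addr0.
Qed.

End Presentations.

(** * Base change of presentations *)

Section RowQuotient.
Variables (R : nzRingType) (a b : nat) (h : 'M[R]_(a, b)).

(** A boolean predicate allows the library quotient. The quotient as an abelian group suffices,
    because the universal property in [is_tensor] has abelian groups as targets. *)
Definition row_module : {pred 'rV[R]_b} := fun v => `[< exists u, v = u *m h >].

Lemma row_moduleP v : reflect (exists u, v = u *m h) (v \in row_module).
Proof. exact: asboolP. Qed.

Lemma row_module_zmod_closed : zmod_closed row_module.
Proof.
split=> [|u v /row_moduleP[u' ->] /row_moduleP[v' ->]]; apply/row_moduleP.
  by exists 0; rewrite mul0mx.
by exists (u' - v'); rewrite mulmxBl.
Qed.

HB.instance Definition _ :=
  GRing.isZmodClosed.Build 'rV[R]_b row_module row_module_zmod_closed.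

End RowQuotient.

Local Open Scope quotient_scope.

(** Right exactness from the universal property: [q] sends basis vectors to the tensors of [1] with
    the generators, and a map [psi] back to the quotient of ['rV[S]_b] by the rows satisfies
    [psi (q v) = \pi_Q v], which bounds the kernel of [q]. *)
Lemma presents_base_change (R S : nzRingType) (f : {rmorphism R -> S})
    (M : lmodType R) (T : lmodType S) (tau : S -> M -> T) (a b : nat)
    (h : 'M[R]_(a, b)) :
  is_tensor f tau -> presents M h -> presents T (map_mx f h).
Proof.
move=> [tau_bal tauZ univ] [p [psurj pker]].
have [tauDl tauDr tau_bil] := tau_bal.
pose fh := map_mx f h.
have tau1D : {morph tau 1 : m m' / m + m'} by move=> m m'; exact: tauDr.
have tau10 : tau 1 0 = 0 by apply: (@addrI _ (tau 1 0)); rewrite -tauDr !addr0.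
have [q qE] := row_linear (fun i : 'I_b => tau 1 (p (delta_mx 0 i))).
have qf w : q (map_mx f w) = tau 1 (p w).
  rewrite qE linear_rowE (big_morph _ tau1D tau10).
  by apply: eq_bigr => i _; rewrite mxE tauZ mulr1 -tau_bil mul1r.
have q_ker v : v \in row_module fh -> q v = 0.
  move=> /row_moduleP[u ->]; rewrite linear_mulmxE big1 // => i _.
  have ph0 : p (row i h) = 0 by apply/pker; exists (delta_mx 0 i); rewrite rowE.
  by rewrite -map_row qf ph0 tau10 scaler0.
pose Q := Quotient.quot (row_module fh).
have piP (v w : 'rV[S]_b) : v - w \in row_module fh -> \pi_Q v = \pi_Q w.
  by rewrite Quotient.idealrBE => /eqP.
have q_pi (v w : 'rV[S]_b) : \pi_Q v = \pi_Q w -> q v = q w.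
  move/eqP; rewrite -Quotient.idealrBE => /q_ker.
  by rewrite linearB => /eqP; rewrite subr_eq0 => /eqP.
(* Two lifts of an element of [M] differ by relations, which vanish in [Q]; hence [beta] is balanced
   although [lift] is an arbitrary choice. *)
have piM s w w' : p w = p w' ->
    \pi_Q (s *: map_mx f w) = \pi_Q (s *: map_mx f w').
  move=> eqp; apply: piP; have /pker[u wE] : p (w - w') = 0.
    by rewrite linearB /= eqp subrr.
  apply/row_moduleP; exists (s *: map_mx f u).
  by rewrite -scalerBr -map_mxB wE map_mxM scalemxAl.
pose lift m := sval (cid (psurj m)).
have liftK m : p (lift m) = m by exact: svalP (cid (psurj m)).
pose beta s m := \pi_Q (s *: map_mx f (lift m)).
have beta_bal : balanced f beta.
  split=> [s s' m|s m m'|s r m]; rewrite /beta.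
  - by rewrite scalerDl raddfD.
  - rewrite -raddfD /= -scalerDr -map_mxD; apply: piM.
    by rewrite linearD /= !liftK.
  - rewrite -scalerA -map_mxZ; apply: piM.
    by rewrite linearZ /= !liftK.
have [psi [psiE _]] := univ Q beta beta_bal.
have psi_q v : psi (q v) = \pi_Q v.
  rewrite qE {2}[v]row_sum_delta !raddf_sum; apply: eq_bigr => i _ /=.
  rewrite tauZ mulr1 psiE -(map_delta_mx f); apply: piM.
  by rewrite liftK.
exists q; split; last first.
  move=> v; split=> [qv|[u ->]]; last by apply: q_ker; apply/row_moduleP; exists u.
  apply/row_moduleP; rewrite -[v]subr0 Quotient.idealrBE -!psi_q qv.
  by rewrite !raddf0.
(* For surjectivity: [g] has values in the image of [q], and it is the identity because it is
   additive and fixes all pure tensors. *)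
pose g t := q (repr (psi t)).
have g_zmod : zmod_morphism g.
  by move=> t t'; rewrite /g -linearB; apply: q_pi; rewrite !raddfB /= !reprK.
pose G : {additive T -> T} := HB.pack g (GRing.isZmodMorphism.Build T T g g_zmod).
(* Uniqueness for [tau] itself: [G] and [idfun] both factor it, so both equal [psi0]. *)
have [psi0 [_ psi0_uniq]] := univ T tau tau_bal.
have G_tau s m : G (tau s m) = tau s m.
  rewrite /= /g psiE -[in RHS](liftK m) -[s in RHS]mulr1 -tauZ -qf -linearZ.
  by apply: q_pi; rewrite reprK.
move=> t; exists (repr (psi t)); rewrite -/(g t) -[g t]/(G t).
by rewrite (psi0_uniq G G_tau) -(psi0_uniq idfun).
Qed.

(** * Row selections in block matrices *)

Section OrdSum.
Variables (a1 a2 b1 b2 : nat) (f : 'I_b1 -> 'I_a1) (g : 'I_b2 -> 'I_a2).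

Definition ord_sum (i : 'I_(b1 + b2)) : 'I_(a1 + a2) :=
  match split i with inl j => lshift a2 (f j) | inr j => rshift a1 (g j) end.

Lemma ord_sum_homo : {homo f : i j / (i < j)%N} -> {homo g : i j / (i < j)%N} ->
  {homo ord_sum : i j / (i < j)%N}.
Proof.
move=> fmono gmono i j; rewrite /ord_sum.
case: split_ordP => i' ->; case: split_ordP => j' -> /=.
- exact: fmono.
- by move=> _; rewrite ltn_addr.
- by rewrite ltnNge ltnW // ltn_addr.
- by rewrite !ltn_add2l; exact: gmono.
Qed.

Lemma rowsub_block (R : Type) (c1 c2 : nat) (X11 : 'M[R]_(a1, c1)) X12 X21
    (X22 : 'M[R]_(a2, c2)) :
  rowsub ord_sum (block_mx X11 X12 X21 X22) =
  block_mx (rowsub f X11) (rowsub f X12) (rowsub g X21) (rowsub g X22).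
Proof.
apply/matrixP => i j; rewrite /ord_sum !mxE.
by case: (split i) => i'; rewrite ?(unsplitK (inl _)) ?(unsplitK (inr _));
   rewrite !mxE; case: (split j) => j'; rewrite !mxE.
Qed.

End OrdSum.

(** * Fitting invariants under joining and base change *)

Section FittingIdeals.
Variables (F : fieldType) (A : falgType F).

Section OneOrder.
Variable L : subringClosed A.

Lemma Fit_gen (a b : nat) (h : 'M[subring L]_(a, b)) (f : 'I_b -> 'I_a) u z :
  (b <= a)%N -> {homo f : i j / (i < j)%N} -> U_ L u ->
  is_nr (to_mx (rowsub f h)) z -> Fit h (u * z).
Proof.
move=> leba fmono Uu nrz; rewrite /Fit leba; apply: lspan_gen => //.
by exists (rowsub f h); split=> //; exists f.
Qed.

(** The hypothesis [P 0] covers the case of fewer rows than columns, so later arguments need no case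
    split. *)
Lemma Fit_ind (a b : nat) (h : 'M[subring L]_(a, b)) (P : set A) :
  P 0 -> (forall x y, P x -> P y -> P (x + y)) ->
  (forall (f : 'I_b -> 'I_a) u z, (b <= a)%N -> {homo f : i j / (i < j)%N} -> U_ L u ->
     is_nr (to_mx (rowsub f h)) z -> P (u * z)) ->
  Fit h `<=` P.
Proof.
move=> P0 PD Pgen x; rewrite /Fit; case: ifP => [leba|_ -> //].
apply: lspan_sub => // u z Uu [_ [[f [fmono ->]] nrz]].
exact: Pgen nrz.
Qed.

Variables (a1 a2 b1 b2 : nat) (h1 : 'M[subring L]_(a1, b1))
  (h2 : 'M[subring L]_(a2, b2)) (al : 'M[subring L]_(b2, b1))
  (be : 'M[subring L]_(b1, b2)).

Let le_join : (b1 + b2 <= (a1 + b2) + (b1 + a2))%N.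
Proof. by rewrite addnC [leqRHS]addnACA addnC leq_add // ?leq_addl ?leq_addr. Qed.

(** A minor of [h1], extended by all rows [(-al, 1)], becomes a block lower triangular minor of the
    join with the same reduced norm. *)
Lemma Fit_join_l : Fit h1 `<=` Fit (join_relations h1 h2 al be).
Proof.
apply: Fit_ind; [exact: Fit0 | by move=> x y; exact: FitD |].
move=> f u z _ fmono Uu nrz; rewrite -[z]mulr1.
apply: (Fit_gen (f := lshift (b1 + a2) \o ord_sum f id)) => //.
  by move=> i j; exact: ord_sum_homo.
rewrite rowsub_comp -usubmxEsub col_mxKu rowsub_block !mxsub_id raddf0.
rewrite to_mx_block to_mx0 to_mx1.
by apply: is_nr_lblock nrz (is_nr1 _ _).
Qed.

(** Here all rows [(1, -be)] precede the selected rows of [(0, h2)], giving a block upper triangular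
    minor. *)
Lemma Fit_join_r : Fit h2 `<=` Fit (join_relations h1 h2 al be).
Proof.
apply: Fit_ind; [exact: Fit0 | by move=> x y; exact: FitD |].
move=> f u z _ fmono Uu nrz; rewrite -[z]mul1r.
apply: (Fit_gen (f := @rshift (a1 + b2) (b1 + a2) \o ord_sum id f)) => //.
  by move=> i j ij; rewrite /= ltn_add2l; exact: ord_sum_homo.
rewrite rowsub_comp -dsubmxEsub col_mxKd rowsub_block !mxsub_id raddf0.
rewrite to_mx_block to_mx0 to_mx1.
by apply: is_nr_ublock (is_nr1 _ _) nrz.
Qed.

End OneOrder.

(** Joining [h] to a presentation that realises [X] can only enlarge [X], so by maximality the join
    still realises [X]; it also contains [Fit h]. *)
Lemma Fitmax_greatest (L : subringClosed A) (M : lmodType (subring L))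
    (X : set A) (a b : nat) (h : 'M[subring L]_(a, b)) :
  is_Fitmax M X -> presents M h -> Fit h `<=` X.
Proof.
move=> [[[a' [b' [h' [h'M ->]]]] Xmax] _] hM.
have [al [be joinM]] := presents_join hM h'M.
have <- : Fit (join_relations h h' al be) = Fit h'.
  apply: Xmax; last exact: Fit_join_r.
  by do 3 eexists; split; first exact: joinM.
exact: Fit_join_l.
Qed.

Lemma to_mx_incl (L L' : subringClosed A) (sub : {subset L <= L'}) (a b : nat)
    (H : 'M[subring L]_(a, b)) :
  to_mx (map_mx (subring_incl sub) H) = to_mx H.
Proof. by apply/matrixP => i j; rewrite !mxE. Qed.

(** An invertible matrix over [L] stays invertible over [L'] with the same reduced norm; the
    coefficients are handled by the inclusion of centres. *)
Lemma U_sub (L L' : subringClosed A) (sub : {subset L <= L'}) :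
  centre [set x | x \in L] `<=` centre [set x | x \in L'] -> U_ L `<=` U_ L'.
Proof.
move=> csub; apply: lspan_sub; [exact: lspan0 | by move=> x y; exact: lspanD |].
move=> c z Lc [b [H [[K [HK KH]] nrz]]]; apply: lspan_gen; first exact: csub.
exists b, (map_mx (subring_incl sub) H); split; last by rewrite to_mx_incl.
by exists (map_mx (subring_incl sub) K); rewrite -!map_mxM HK KH map_mx1.
Qed.

(** Centrality of [z] turns [u * z * v] into [u * v * z], where [u * v] lies in [U_ L'] and [z] is
    the reduced norm of the corresponding minor over [L']. *)
Lemma Fit_base_change (L L' : subringClosed A) (sub : {subset L <= L'})
    (a b : nat) (h : 'M[subring L]_(a, b)) :
  U_ L `<=` U_ L' -> lspan (Fit h) (U_ L') `<=` Fit (map_mx (subring_incl sub) h).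
Proof.
move=> Usub; apply: lspan_sub; [exact: Fit0 | by move=> x y; exact: FitD |].
move=> x v hx Uv; move: x hx.
apply: (Fit_ind
  (P := [set x | Fit (map_mx (subring_incl sub) h) (x * v)])) => /=.
- by rewrite mul0r; exact: Fit0.
- by move=> x y Px Py; rewrite mulrDl; exact: FitD.
move=> f u z leba fmono Uu nrz.
have -> : u * z * v = u * v * z by rewrite -!mulrA; case: nrz => -[_ ->].
apply: Fit_gen leba fmono _ _; first by apply: U_M => //; exact: Usub.
by rewrite -map_mxsub to_mx_incl.
Qed.

End FittingIdeals.

(** An element that commutes with an [F]-spanning set of [A] commutes with all of [A]. *)
Lemma centre_order (o : idomainType) (A : falgType {fraction o})
    (L : subringClosed A) :
  is_order L -> centre [set x | x \in L] `<=` centre setT.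
Proof.
move=> [s [LE s_span]] x [Lx cx]; split=> // y _.
have /coord_span-> : y \in <<in_tuple s>>%VS by rewrite s_span memvf.
rewrite mulr_sumr mulr_suml; apply: eq_bigr => i _.
rewrite -scalerAl -scalerAr cx //=; apply/LE; exists (fun j => (j == i)%:R).
rewrite (bigD1 i) //= eqxx rmorph1 scale1r big1 ?addr0 // => j /negPf->.
by rewrite rmorph0 scale0r.
Qed.

Theorem proposition6p9 (o : idomainType) (A : falgType {fraction o})
    (Lam Gam : subringClosed A)
    (LamFO : fitting_order Lam) (GamFO : fitting_order Gam)
    (LamGam : {subset Lam <= Gam})
    (M : lmodType (subring Lam)) (Mfg : finitely_generated M)
    (T : lmodType (subring Gam)) (tau : subring Gam -> M -> T)
    (Ttensor : is_tensor (subring_incl LamGam) tau)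
    (FitM FitT : set A)
    (FitMmax : is_Fitmax M FitM) (FitTmax : is_Fitmax T FitT) :
  lspan FitM (U_ Gam) `<=` FitT.
Proof.
have [[[a [b [h [hM ->]]]] _] _] := FitMmax.
have [_ _ Lam_order] := LamFO.
(* It suffices to reach the Fitting invariant of the base change of the presentation [h] that
   realises [FitM]. *)
apply: subset_trans (Fitmax_greatest FitTmax (presents_base_change Ttensor hM)).
apply: Fit_base_change; apply: (U_sub LamGam) => x Lx.
have [_ xc] := centre_order Lam_order Lx.
by split=> [|y _]; [exact: (LamGam _ (proj1 Lx)) | exact: xc].
Qed.
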